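(* Let $a,b>0$ be such that $b/a=\frac{\log n}{\log 2}$ for some integer $n\ge2$. Then the tiling $\hat{\mathcal T}=\{\hat R^i\circ\hat S^j\circ\hat T_k(\hat P): i,j,k\in\mathbb{Z}\}$ of $Sol(a,b)$ is face-to-face and repetitive. Moreover, the prototile $\hat P$ admits a finite number of decorations such that $\hat{\mathcal T}$ also becomes aperiodic; that is, there exist a finite set $C$ and a labelling of the tiles of $\hat{\mathcal T}$ by elements of $C$ such that the resulting decorated tiling is repetitive and aperiodic.
   Context: **The group.** For real $a,b>0$, $Sol(a,b)=\mathbb{R}^2\rtimes\mathbb{R}$ is $\mathbb{R}^3$ with product $(x,y,z)\cdot(x',y',z')=(x+e^{az}x',\,y+e^{-bz}y',\,z+z')$ and the left invariant Riemannian metric $e^{-2az}dx^2+e^{2bz}dy^2+dz^2$. **The tile.** In the upper half-plane $\mathbb{H}=\{\alpha+i\beta:\beta>0\}$, let $P$ be the hyperbolic pentagon with vertices $i,\ \tfrac12+i,\ 1+i,\ 1+2i,\ 2i$ and geodesic sides: explicitly, with $\tau(\alpha)=\sqrt{4+\alpha(1-\alpha)}$ on $[0,1]$, $P$ is the set of $\alpha+i\beta$ with $0\le\alpha\le1$, $\beta\le\tau(\alpha)$, and $\beta\ge\frac12\tau(2\alpha)$ if $\alpha\le\frac12$, $\beta\ge\frac12\tau(2\alpha-1)$ if $\alpha\ge\frac12$. Identify $\alpha+i\beta\in\mathbb H$ with $(\alpha,0,\tfrac{\log\beta}{a})\in Sol(a,b)$. Let $\hat R,\hat S,\hat T_s$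 be the left translations of $Sol(a,b)$ by $(0,0,\tfrac{\log 2}{a})$, $(1,0,0)$, $(0,s,0)$ respectively, and $\hat P=\bigcup_{s\in[0,1]}\hat T_s(P)$. **Faces.** The faces of $\hat P$ are: the sets $\bigcup_{s\in[0,1]}\hat T_s(\sigma)$ for $\sigma$ each of the two vertical sides and each of the two bottom sides (from $i$ to $\tfrac12+i$ and from $\tfrac12+i$ to $1+i$) of $P$; the two sets $P$ and $\hat T_1(P)$; and the $n$ sets $\bigcup_{s\in[\frac{l-1}{n},\frac{l}{n}]}\hat T_s(\tau)$, $l=1,\dots,n$, where here $\tau$ denotes the top side of $P$ (from $2i$ to $1+2i$). Faces of other tiles are the images under the corresponding left translations. The tiling is face-to-face if, whenever two distinct tiles share a relative interior point of a face of one of them, that face is a face of both. **Repetitive, aperiodic.** A patch is a finite set of (decorated) tiles of the tiling. A tiling is repetitive if for each patch $\mathcal P$ there is $r>0$ such that every ball of radius $r$ in $Sol(a,b)$ contains a left translate $g\mathcal P$, $g\in Sol(a,b)$, of $\mathcal{P}$ which is also a patch of the tiling (with the same decorations, if decorated). A (decorated) tiling is aperiodic if no nontrivial element of $Sol(a,b)$ preserves it by left translation (respecting decorations). *)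

(* Defs.v *)
From HB Require Import structures.
From mathcomp Require Import all_boot all_order all_algebra.
From mathcomp Require Import all_classical all_reals all_analysis.

Set Implicit Arguments.
Unset Strict Implicit.
Unset Printing Implicit Defensive.

Import Order.TTheory GRing.Theory Num.Theory.
Import numFieldNormedType.Exports.

Local Open Scope classical_set_scope.
Local Open Scope ring_scope.

Definition Sol (R : realType) (a b : R) : Type := (R * R * R)%type.

Definition sol_mul (R : realType) (a b : R) (p q : Sol a b) : Sol a b :=
  (p.1.1 + expR (a * p.2) * q.1.1,
   p.1.2 + expR (- b * p.2) * q.1.2,
   p.2 + q.2).

Definition sol_one (R : realType) (a b : R) : Sol a b := (0, 0, 0).

Definition sol_inv (R : realType) (a b : R) (p : Sol a b) : Sol a b :=
  (- (expR (- a * p.2) * p.1.1), - (expR (b * p.2) * p.1.2), - p.2).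

Lemma sol_mulA (R : realType) (a b : R) : associative (@sol_mul R a b).
Proof.
move=> [[x y] z] [[x' y'] z'] [[x'' y''] z'']; rewrite /sol_mul /=.
by rewrite !mulrDr !expRD !addrA !mulrA.
Qed.

Lemma sol_mul1 (R : realType) (a b : R) :
  left_id (sol_one a b) (@sol_mul R a b).
Proof.
move=> [[x y] z]; rewrite /sol_mul /sol_one /=.
by rewrite !mulr0 expR0 !mul1r !add0r.
Qed.

Lemma sol_mulr1 (R : realType) (a b : R) :
  right_id (sol_one a b) (@sol_mul R a b).
Proof.
by move=> [[x y] z]; rewrite /sol_mul /sol_one /= !mulr0 !addr0.
Qed.

Lemma sol_mulV (R : realType) (a b : R) :
  left_inverse (sol_one a b) (@sol_inv R a b) (@sol_mul R a b).
Proof.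
move=> [[x y] z]; rewrite /sol_mul /sol_one /sol_inv /=.
by rewrite mulrN mulNr mulrN mulNr opprK !addNr.
Qed.

Lemma sol_mulrV (R : realType) (a b : R) :
  right_inverse (sol_one a b) (@sol_inv R a b) (@sol_mul R a b).
Proof.
move=> [[x y] z]; rewrite /sol_mul /sol_one /sol_inv /=.
by rewrite !mulrN !mulrA -!expRD !mulNr !(subrr, addNr) expR0 !mul1r !subrr.
Qed.

HB.instance Definition _ (R : realType) (a b : R) :=
  Choice.copy (Sol a b) (R * R * R)%type.

HB.instance Definition _ (R : realType) (a b : R) :=
  Topological.copy (Sol a b) (R * R * R)%type.

HB.instance Definition _ (R : realType) (a b : R) :=
  isGroup.Build (Sol a b) (@sol_mulA R a b) (@sol_mul1 R a b) (@sol_mulr1 R a b)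
    (@sol_mulV R a b) (@sol_mulrV R a b).

Definition ltrans (R : realType) (a b : R) (g : Sol a b) : Sol a b -> Sol a b :=
  fun p => (g * p)%g.

Definition expgz (G : groupType) (g : G) (m : int) : G :=
  match m with
  | Posz k => (g ^+ k)%g
  | Negz k => (g ^- k.+1)%g
  end.

(** A C^1 arc is the restriction to [[0,1]] of a C^1 map [R -> R^3]. *)
Definition C1 (R : realType) (f : R -> R) : Prop :=
  (forall t, derivable f t 1) /\ continuous (derive1 f).

Definition C1_arc (R : realType) (a b : R) (c : R -> Sol a b) : Prop :=
  [/\ C1 (fun t => (c t).1.1), C1 (fun t => (c t).1.2) & C1 (fun t => (c t).2)].

(** Norm of the tangent vector [(vx, vy, vz)] at [p] for the metric
    [e^(-2az) dx^2 + e^(2bz) dy^2 + dz^2]. *)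
Definition tangent_norm (R : realType) (a b : R) (p : Sol a b) (vx vy vz : R) : R :=
  Num.sqrt (expR (- (2 * a * p.2)) * vx ^+ 2 + expR (2 * b * p.2) * vy ^+ 2
            + vz ^+ 2).

Definition arc_length (R : realType) (a b : R) (c : R -> Sol a b) : R :=
  \int[@lebesgue_measure R]_(t in `[0, 1])
    tangent_norm (c t) (derive1 (fun u => (c u).1.1) t)
                 (derive1 (fun u => (c u).1.2) t) (derive1 (fun u => (c u).2) t).

(** [pw_path p q L]: some piecewise C^1 path from [p] to [q] has length [L]. *)
Inductive pw_path (R : realType) (a b : R) : Sol a b -> Sol a b -> R -> Prop :=
| pw_nil p : pw_path p p 0
| pw_cons (c : R -> Sol a b) q L :
    C1_arc c -> pw_path (c 1) q L -> pw_path (c 0) q (arc_length c + L).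

Definition sol_dist (R : realType) (a b : R) (p q : Sol a b) : R :=
  inf [set L | pw_path p q L].

Definition sol_ball (R : realType) (a b : R) (p : Sol a b) (r : R) : set (Sol a b) :=
  [set q | sol_dist p q < r].

(** Subsets of the half-plane are in the coordinates [(alpha, beta)]; [tau] is
    the height of the geodesic from [2i] to [1+2i]. *)

Definition tau (R : realType) (x : R) : R := Num.sqrt (4 + x * (1 - x)).

Definition pentagon (R : realType) : set (R * R) :=
  [set w | [/\ 0 <= w.1 <= 1,
               w.2 <= tau w.1,
               w.1 <= 2^-1 -> 2^-1 * tau (2 * w.1) <= w.2 &
               2^-1 <= w.1 -> 2^-1 * tau (2 * w.1 - 1) <= w.2]].
Arguments pentagon {R}.

Inductive pside := SLeft | SRight | SBotL | SBotR | STop.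

Definition side (R : realType) (s : pside) : set (R * R) :=
  match s with
  | SLeft => [set w | w.1 = 0 /\ 1 <= w.2 <= 2]
  | SRight => [set w | w.1 = 1 /\ 1 <= w.2 <= 2]
  | SBotL => [set w | 0 <= w.1 <= 2^-1 /\ w.2 = 2^-1 * tau (2 * w.1)]
  | SBotR => [set w | 2^-1 <= w.1 <= 1 /\ w.2 = 2^-1 * tau (2 * w.1 - 1)]
  | STop => [set w | 0 <= w.1 <= 1 /\ w.2 = tau w.1]
  end.
Arguments side {R} s.

Definition side_ends (R : realType) (s : pside) : set (R * R) :=
  match s with
  | SLeft => [set (0, 1); (0, 2)]
  | SRight => [set (1, 1); (1, 2)]
  | SBotL => [set (0, 1); (2^-1, 1)]
  | SBotR => [set (2^-1, 1); (1, 1)]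
  | STop => [set (0, 2); (1, 2)]
  end.
Arguments side_ends {R} s.

Definition half_plane_emb (R : realType) (a b : R) (w : R * R) : Sol a b :=
  (w.1, 0, ln w.2 / a).
Arguments half_plane_emb {R} a b w.

Definition elR (R : realType) (a b : R) : Sol a b := (0, 0, ln 2 / a).
Definition elS (R : realType) (a b : R) : Sol a b := (1, 0, 0).
Definition elT (R : realType) (a b : R) (s : R) : Sol a b := (0, s, 0).

Definition sweep (R : realType) (a b : R) (I : set R) (W : set (R * R)) :
    set (Sol a b) :=
  \bigcup_(s in I) (ltrans (elT a b s) @` (half_plane_emb a b @` W)).
Arguments sweep {R} a b I W.

Definition hatP (R : realType) (a b : R) : set (Sol a b) :=
  sweep a b `[0, 1] pentagon.
Arguments hatP {R} a b.

(** [FTop l] is the top face over [[l/n, (l+1)/n]], with [l] counted from 0. *)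
Inductive face_index (n : nat) :=
| FLeft | FRight | FBotL | FBotR | FFront | FBack | FTop of 'I_n.

Definition face (R : realType) (a b : R) (n : nat) (f : face_index n) :
    set (Sol a b) :=
  match f with
  | FLeft => sweep a b `[0, 1] (side SLeft)
  | FRight => sweep a b `[0, 1] (side SRight)
  | FBotL => sweep a b `[0, 1] (side SBotL)
  | FBotR => sweep a b `[0, 1] (side SBotR)
  | FFront => half_plane_emb a b @` pentagon
  | FBack => ltrans (elT a b 1) @` (half_plane_emb a b @` pentagon)
  | FTop l => sweep a b `[l%:R / n%:R, l.+1%:R / n%:R] (side STop)
  end.
Arguments face {R} a b {n} f.

Definition open_side (R : realType) (s : pside) : set (R * R) :=
  side s `\` side_ends s.
Arguments open_side {R} s.

(** Relative interior of a face: the face without its boundary edges.  For the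
    two copies of [P] it is the interior of [P] in the half-plane. *)
Definition face_relint (R : realType) (a b : R) (n : nat) (f : face_index n) :
    set (Sol a b) :=
  match f with
  | FLeft => sweep a b `]0, 1[ (open_side SLeft)
  | FRight => sweep a b `]0, 1[ (open_side SRight)
  | FBotL => sweep a b `]0, 1[ (open_side SBotL)
  | FBotR => sweep a b `]0, 1[ (open_side SBotR)
  | FFront => half_plane_emb a b @` pentagon°
  | FBack => ltrans (elT a b 1) @` (half_plane_emb a b @` pentagon°)
  | FTop l => sweep a b `]l%:R / n%:R, l.+1%:R / n%:R[ (open_side STop)
  end.
Arguments face_relint {R} a b {n} f.

Definition tile_map (R : realType) (a b : R) (i j k : int) : Sol a b -> Sol a b :=
  ltrans (expgz (elR a b) i) \o ltrans (expgz (elS a b) j)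
    \o ltrans (elT a b k%:~R).
Arguments tile_map {R} a b i j k _.

Definition hatT (R : realType) (a b : R) : set (set (Sol a b)) :=
  [set t | exists i j k : int, t = tile_map a b i j k @` hatP a b].
Arguments hatT {R} a b.

Definition is_tiling (R : realType) (a b : R) (T : set (set (Sol a b))) : Prop :=
  \bigcup_(t in T) t = setT /\
  (forall t1 t2, T t1 -> T t2 -> t1 <> t2 -> t1° `&` t2° = set0).

Definition face_of (R : realType) (a b : R) (n : nat) (t F : set (Sol a b)) : Prop :=
  exists (i j k : int) (f : face_index n),
    t = tile_map a b i j k @` hatP a b /\ F = tile_map a b i j k @` face a b f.

Definition face_relint_point (R : realType) (a b : R) (n : nat)
    (t F : set (Sol a b)) (p : Sol a b) : Prop :=
  exists (i j k : int) (f : face_index n),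
    [/\ t = tile_map a b i j k @` hatP a b, F = tile_map a b i j k @` face a b f
      & (tile_map a b i j k @` face_relint a b f) p].

(** The faces of the tile with index [(i,j,k)] are the translates of those of
    [hatP].  Exchanging [t1] and [t2] accounts for the faces of either tile. *)
Definition face_to_face (R : realType) (a b : R) (n : nat) : Prop :=
  forall t1 t2 : set (Sol a b), hatT a b t1 -> hatT a b t2 -> t1 <> t2 ->
  forall (F : set (Sol a b)) (p : Sol a b),
    t1 p -> t2 p -> face_relint_point n t1 F p ->
    face_of n t1 F /\ face_of n t2 F.
Arguments face_to_face {R} a b n.

(** [D] is a type of tiles, decorated or not, with left translation [act] and
    underlying subset [supp]. *)
Definition is_patch (D : Type) (T P : set D) : Prop :=
  finite_set P /\ P `<=` T.

Definition repetitive (R : realType) (a b : R) (D : Type)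
    (act : Sol a b -> D -> D) (supp : D -> set (Sol a b)) (T : set D) : Prop :=
  forall P : set D, is_patch T P ->
  exists2 r : R, 0 < r &
    forall q : Sol a b, exists g : Sol a b,
      is_patch T (act g @` P) /\
      \bigcup_(t in act g @` P) supp t `<=` sol_ball q r.

Definition aperiodic (R : realType) (a b : R) (D : Type)
    (act : Sol a b -> D -> D) (T : set D) : Prop :=
  forall g : Sol a b, act g @` T = T -> g = 1%g.

Definition tile_act (R : realType) (a b : R) (g : Sol a b) (t : set (Sol a b)) :
    set (Sol a b) :=
  ltrans g @` t.
Arguments tile_act {R} a b g t.

Definition dtile_act (R : realType) (a b : R) (C : Type) (g : Sol a b)
    (d : set (Sol a b) * C) : set (Sol a b) * C :=
  (tile_act a b g d.1, d.2).
Arguments dtile_act {R} a b C g d.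

(** Only the values of [lab] on [T] matter. *)
Definition decorate (R : realType) (a b : R) (C : Type) (T : set (set (Sol a b)))
    (lab : set (Sol a b) -> C) : set (set (Sol a b) * C) :=
  [set (t, lab t) | t in T].

(* Main.v *)
(** In the coordinates [(x, y, exp (a z))] the tile of index [(i, j, k)] is
    [{j <= 2^-i x <= j + 1, k <= n^i y <= k + 1, c_(i-1) x <= exp (a z) <= c_i x}],
    where [c_i x = 2^i c_0 (2^-i x)] and [c_0] is the 1-periodic continuation of
    [tau].  As [2 <= c_0 < 4], the graphs of the [c_i] are strictly ordered, so
    [i], then [j] and [k], can be read off an interior point; this gives the
    tiling.  At a relative interior point of a face all but one of the conditions
    are strict, so the other tile is the neighbour across that condition; across
    a top side [i] increases by one, while [j] is halved and [k] multiplied by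
    [n], up to the remainder that selects the face.

    Colour the tile [(i, j, k)] by the parity of the 2-adic valuation of [i].
    The translations of index [(2^(2M) (2t + 1), 2^M J, n^M K)] preserve the tiles
    with [|i| <= M] together with their colours, and they form a relatively
    dense set for the left invariant metric.  A symmetry of the decorated tiling
    has an index [(i, j, k)] with [i] a period of the colouring, hence [i = 0],
    and with [2^-m j] and [n^-m k] integers for all [m], hence [j = k = 0]. *)

Require Import Defs.
From mathcomp Require Import all_boot all_order all_algebra.
From mathcomp Require Import all_classical all_reals all_analysis.
From mathcomp Require Import zify ring lra.

Set Implicit Arguments.
Unset Strict Implicit.
Unset Printing Implicit Defensive.

Import Order.TTheory GRing.Theory Num.Theory.
Import numFieldNormedType.Exports.

Local Open Scope classical_set_scope.
Local Open Scope ring_scope.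

(** * Periodic profile of a row of tiles and the sides of the pentagon *)

Section Profile.
Context {R : realType}.
Implicit Types (x : R) (m : int).

(* The periodic continuation of [tau]: the top boundary of a whole row of tiles. *)
Definition wave x : R := tau (x - (Num.floor x)%:~R).

Lemma tau_itv x : 0 <= x <= 1 -> 2 <= tau x < 4.
Proof.
move=> /andP[x0 x1]; rewrite /tau.
have e2 : 2 = Num.sqrt (4 : R).
  have -> : (4 : R) = 2 ^+ 2 by ring.
  by rewrite sqrtr_sqr ger0_norm.
have e4 : 4 = Num.sqrt (16 : R).
  have -> : (16 : R) = 4 ^+ 2 by ring.
  by rewrite sqrtr_sqr ger0_norm.
have ? : 0 <= x * (1 - x) by rewrite mulr_ge0 ?subr_ge0.
apply/andP; split.
  by rewrite {1}e2 ler_sqrt; lra.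
rewrite [ltRHS]e4 ltr_sqrt; nra.
Qed.

Lemma wave_itv x : 2 <= wave x < 4.
Proof.
by apply: tau_itv; have := floor_itv x; rewrite intrD; lra.
Qed.

Lemma wave_ge x : 2 <= wave x. Proof. by have /andP[] := wave_itv x. Qed.
Lemma wave_lt x : wave x < 4. Proof. by have /andP[] := wave_itv x. Qed.

Lemma waveD x m : wave (x + m%:~R) = wave x.
Proof.
by rewrite /wave floorDrz ?intrD ?intr_int // intrKfloor; congr tau; ring.
Qed.

Lemma waveB x m : wave (x - m%:~R) = wave x.
Proof. by rewrite -mulrNz waveD. Qed.

Lemma wave_tau x : 0 <= x <= 1 -> wave x = tau x.
Proof.
move=> /andP[x0]; rewrite le_eqVlt => /predU1P[->|x1].
  by rewrite /wave floor1 /tau; congr Num.sqrt; ring.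
rewrite /wave (_ : Num.floor x = 0) ?subr0 //.
by apply/eqP; rewrite floor_eq add0r x0.
Qed.

Lemma wave_int m : wave m%:~R = 2.
Proof.
rewrite -[m%:~R]add0r waveD wave_tau ?lexx ?ler01 // /tau mul0r addr0.
have -> : (4 : R) = 2 ^+ 2 by ring.
by rewrite sqrtr_sqr ger0_norm.
Qed.

(** Since [2 <= wave < 4] everywhere, the bottom stays below 2 and the top does not. *)
Lemma wave_half_lt x : wave (2 * x) / 2 < wave x.
Proof. by have := wave_lt (2 * x); have := wave_ge x; lra. Qed.

(** The two bottom sides are half-size copies of the top side, so periodicity merges them into the
    single graph of [wave (2 * x) / 2]. Integer horizontal shifts then leave both height bounds
    unchanged. *)
Lemma pentagonE (w : R * R) :
  pentagon w <-> 0 <= w.1 <= 1 /\ wave (2 * w.1) / 2 <= w.2 <= wave w.1.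
Proof.
case: w => x w; rewrite /pentagon /=.
have E0 : 0 <= x <= 2^-1 -> wave (2 * x) = tau (2 * x).
  by move=> ?; apply: wave_tau; lra.
have E1 : 2^-1 <= x <= 1 -> wave (2 * x) = tau (2 * x - 1).
  by move=> ?; rewrite -(waveB _ 1) wave_tau //; lra.
split.
  case=> /andP[x0 x1] wt h1 h2; rewrite x0 x1 [wave x]wave_tau ?x0 // wt andbT.
  split=> //; have [xh|/ltW xh] := leP x 2^-1.
    by rewrite E0 ?x0 // [leLHS]mulrC h1.
  by rewrite E1 ?xh // [leLHS]mulrC h2.
case=> /[dup] x01 /andP[x0 x1] /andP[lo up]; split=> //.
- by rewrite -wave_tau.
- by move=> xh; rewrite -E0 ?x0 // [leLHS]mulrC.
- by move=> xh; rewrite -E1 ?xh // [leLHS]mulrC.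
Qed.

(** On the vertical sides [wave] is evaluated at integers, where it equals 2; this turns the range
    from 1 to 2 into the same height bounds as in [pentagonE]. *)
Lemma sideE (s : pside) (w : R * R) : side s w <->
  match s with
  | SLeft => w.1 = 0 /\ wave (2 * w.1) / 2 <= w.2 <= wave w.1
  | SRight => w.1 = 1 /\ wave (2 * w.1) / 2 <= w.2 <= wave w.1
  | SBotL => 0 <= w.1 <= 2^-1 /\ w.2 = wave (2 * w.1) / 2
  | SBotR => 2^-1 <= w.1 <= 1 /\ w.2 = wave (2 * w.1) / 2
  | STop => 0 <= w.1 <= 1 /\ w.2 = wave w.1
  end.
Proof.
case: w => x w; case: s => /=.
- suff E : x = 0 -> wave (2 * x) = 2 /\ wave x = 2.
    by split=> -[x0 h]; split=> //; have [e1 e2] := E x0;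
       move: h; rewrite ?e1 ?e2 divff.
  by move->; rewrite mulr0 (wave_int 0).
- suff E : x = 1 -> wave (2 * x) = 2 /\ wave x = 2.
    by split=> -[x0 h]; split=> //; have [e1 e2] := E x0;
       move: h; rewrite ?e1 ?e2 divff.
  by move->; rewrite mulr1 (wave_int 1) (wave_int 2).
- suff E : 0 <= x <= 2^-1 -> wave (2 * x) = tau (2 * x).
    by split=> -[x0 h]; split=> //; rewrite h E // mulrC.
  by move=> ?; apply: wave_tau; lra.
- suff E : 2^-1 <= x <= 1 -> wave (2 * x) = tau (2 * x - 1).
    by split=> -[x0 h]; split=> //; rewrite h E // mulrC.
  by move=> ?; rewrite -(waveB _ 1) wave_tau //; lra.
- by split=> -[x0 ->]; rewrite wave_tau.
Qed.

Lemma side_sub_pentagon s : (side s : set (R * R)) `<=` pentagon.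
Proof.
move=> w /sideE h; apply/pentagonE.
case: s h => -[h1 h2]; have := wave_half_lt w.1; lra.
Qed.

Lemma pentagon_gt0 (w : R * R) : pentagon w -> 0 < w.2.
Proof. by move/pentagonE => [_ /andP[+ _]]; have := wave_ge (2 * w.1); lra. Qed.

(** An end point is singled out by its height on a vertical side and by its abscissa on the others;
    excluding both ends makes the corresponding inequalities strict. *)
Lemma open_sideE (s : pside) (w : R * R) : open_side s w ->
  match s with
  | SLeft => w.1 = 0 /\ wave (2 * w.1) / 2 < w.2 < wave w.1
  | SRight => w.1 = 1 /\ wave (2 * w.1) / 2 < w.2 < wave w.1
  | SBotL => 0 < w.1 < 2^-1 /\ w.2 = wave (2 * w.1) / 2
  | SBotR => 2^-1 < w.1 < 1 /\ w.2 = wave (2 * w.1) / 2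
  | STop => 0 < w.1 < 1 /\ w.2 = wave w.1
  end.
Proof.
move=> [/sideE + nend]; case: w nend => x w.
have W0 : wave (0 : R) = 2 := wave_int 0.
have W1 : wave (1 : R) = 2 := wave_int 1.
have W2 : wave (2 : R) = 2 := wave_int 2.
have neq (p q r t : R) : ~ ((p, q) = (r, t)) -> p = r -> q != t.
  by move=> h e; apply/eqP => f; apply: h; rewrite e f.
case: s => /= nend [h1 h2]; split => //.
- move: h2; rewrite h1 mulr0 W0 divff // !le_eqVlt => /andP[].
  have n1 : w != 1 by apply: neq h1 => e; apply: nend; left.
  have n2 : w != 2 by apply: neq h1 => e; apply: nend; right.
  by rewrite eq_sym (negPf n1) (negPf n2) /= => -> ->.
- move: h2; rewrite h1 mulr1 W2 W1 divff // !le_eqVlt => /andP[].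
  have n1 : w != 1 by apply: neq h1 => e; apply: nend; left.
  have n2 : w != 2 by apply: neq h1 => e; apply: nend; right.
  by rewrite eq_sym (negPf n1) (negPf n2) /= => -> ->.
- have n1 : x != 0.
    apply/eqP => x0; apply: nend; left; rewrite h2 x0 mulr0 W0; congr pair; lra.
  have n2 : x != 2^-1.
    apply/eqP => x0; apply: nend; right.
    rewrite h2 x0 divff // W1; congr pair; lra.
  by move: h1; rewrite !le_eqVlt eq_sym (negPf n1) (negPf n2).
- have n1 : x != 2^-1.
    apply/eqP => x0; apply: nend; left.
    rewrite h2 x0 divff // W1; congr pair; lra.
  have n2 : x != 1.
    apply/eqP => x0; apply: nend; right; rewrite h2 x0 mulr1 W2; congr pair; lra.
  by move: h1; rewrite !le_eqVlt eq_sym (negPf n1) (negPf n2).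
- have n1 : x != 0.
    by apply/eqP => x0; apply: nend; left; rewrite h2 x0 W0.
  have n2 : x != 1.
    by apply/eqP => x0; apply: nend; right; rewrite h2 x0 W1.
  by move: h1; rewrite !le_eqVlt eq_sym (negPf n1) (negPf n2).
Qed.

End Profile.

(** * Rescaled coordinates in which every tile has the same equations *)

Section Tile.
Context {R : realType} (a b : R) (n : nat).
Context (ha : 0 < a) (hn : (2 <= n)%N).
Context (hab : b / a = ln (n%:R : R) / ln (2 : R)).
Implicit Types (i j k : int) (p : Sol a b).
Local Notation N := (n%:R : R).

Let N0 : 0 < N. Proof. by rewrite ltr0n; exact: leq_trans hn. Qed.
Let N_neq0 : N != 0. Proof. exact: lt0r_neq0. Qed.
Let ln2_gt0 : 0 < ln (2 : R). Proof. by rewrite ln_gt0 // ltr1n. Qed.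

Lemma expR_intM_ln (x : R) i : 0 < x -> expR (i%:~R * ln x) = x ^ i.
Proof.
move=> x0; case: i => m.
  by rewrite -pmulrn expRM_natl lnK.
by rewrite NegzE intrN mulNr expRN -pmulrn expRM_natl lnK // exprnN.
Qed.

Definition level i : R := i%:~R * (ln 2 / a).

Lemma expR_level i : expR (a * level i) = 2 ^ i.
Proof.
rewrite -expR_intM_ln //; congr expR.
by rewrite /level; field; rewrite gt_eqF.
Qed.

(** The relation between [a], [b] and [n] enters here: it gives [b * (ln 2 / a) = ln n], so one
    level up contracts the second axis by exactly [n]. *)
Lemma expR_levelN i : expR (- b * level i) = (N ^ i)^-1.
Proof.
rewrite -[N ^ i]expR_intM_ln // -expRN; congr expR.
have -> : b = a * (ln N / ln 2) by rewrite -hab; field; rewrite gt_eqF.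
by rewrite /level; field; rewrite !gt_eqF.
Qed.

(** The group element by which [tile_map a b i j k] translates. *)
Definition vertex i j k : Sol a b := (2 ^ i * j%:~R, k%:~R / N ^ i, level i).

Lemma expgz_elR i : expgz (elR a b) i = (0, 0, level i).
Proof.
have H m : (elR a b ^+ m)%g = (0, 0, level m) :> Sol a b.
  elim: m => [|m IHm]; first by rewrite expg0 /level mul0r.
  rewrite expgS IHm; congr (_, _, _) => /=; rewrite ?mulr0 ?addr0 //.
  by rewrite /level -[in RHS]addn1 PoszD intrD mulrDl mul1r addrC.
case: i => m /=; first exact: H.
rewrite H; congr (_, _, _) => /=; rewrite ?mulr0 ?oppr0 //.
by rewrite /level NegzE intrN mulNr.
Qed.

Lemma expgz_elS j : expgz (elS a b) j = (j%:~R, 0, 0).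
Proof.
have H m : (elS a b ^+ m)%g = (m%:~R, 0, 0) :> Sol a b.
  elim: m => [|m IHm]; first by rewrite expg0.
  rewrite expgS IHm; congr (_, _, _) => /=; rewrite ?mulr0 ?addr0 //.
  by rewrite expR0 mul1r -[in RHS]addn1 PoszD intrD addrC.
case: j => m /=; first exact: H.
rewrite H; congr (_, _, _) => /=; rewrite ?mulr0 ?oppr0 //.
by rewrite expR0 mul1r NegzE intrN.
Qed.

Lemma tile_mapE i j k : tile_map a b i j k = ltrans (vertex i j k).
Proof.
apply/funext => p; rewrite /tile_map /ltrans /= !mulgA.
congr (_ * _)%g; rewrite expgz_elR expgz_elS.
congr (_, _, _) => /=; rewrite ?(addr0, add0r, mulr0, expR0, mul1r) //.
  by rewrite expR_level.
by rewrite expR_levelN mulrC.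
Qed.

(* Left translation by the inverse of [vertex i 0 0], with third coordinate
   replaced by the height [expR (a * z)] in the half-plane. *)
Definition locx i p : R := p.1.1 / 2 ^ i.
Definition locy i p : R := p.1.2 * N ^ i.
Definition loch i p : R := expR (a * p.2) / 2 ^ i.

(** Translating back by [vertex i j k] reduces to the sweep itself. Positivity of the heights in [V]
    lets the exponential undo the logarithm of [half_plane_emb]. *)
Lemma tile_sweepP i j k (I : set R) (V : set (R * R)) p :
  V `<=` [set w | 0 < w.2] ->
  (tile_map a b i j k @` sweep a b I V) p <->
  I (locy i p - k%:~R) /\ V (locx i p - j%:~R, loch i p).
Proof.
move=> V0; rewrite tile_mapE.
have P2 : 2 ^ i != 0 :> R by rewrite expfz_neq0.
have PN : N ^ i != 0 by rewrite expfz_neq0.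
split.
  move=> [_ [s Is [_ [w Vw <-] <-]] <-].
  rewrite /locy /locx /loch /= expR_level expR_levelN !mulr0 expR0.
  rewrite !mul1r !add0r addr0 mulrDr expRD expR_level.
  rewrite [a * _]mulrC divfK ?gt_eqF // lnK; last exact: V0.
  split; first by congr I: Is; field.
  congr V: Vw; rewrite [LHS]surjective_pairing; congr pair; field => //.
move=> [Is Vw].
exists ((vertex i j k)^-1 * p)%g; last by rewrite /ltrans mulgA mulgV mul1g.
exists (locy i p - k%:~R) => //; eexists; first by eexists; [exact: Vw|].
have e1 : expR (- a * level i) = (2 ^ i)^-1 by rewrite mulNr expRN expR_level.
have e2 : expR (b * level i) = N ^ i.
  by rewrite -[b]opprK mulNr expRN expR_levelN invrK.
rewrite /half_plane_emb /loch /locx /locy /=.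
congr (_, _, _) => /=; rewrite ?mulr0 ?oppr0 ?expR0 ?mul1r ?add0r ?addr0.
- by rewrite mulrN -mulNr e1; field.
- by rewrite mulrNN e2; field.
- rewrite -expR_level -expRN -expRD expRK; field; exact: lt0r_neq0.
Qed.

Definition in_tile i j k p : Prop :=
  [/\ j%:~R <= locx i p <= j%:~R + 1, k%:~R <= locy i p <= k%:~R + 1 &
      wave (2 * locx i p) / 2 <= loch i p <= wave (locx i p)].

Definition in_tile_strict i j k p : Prop :=
  [/\ j%:~R < locx i p < j%:~R + 1, k%:~R < locy i p < k%:~R + 1 &
      wave (2 * locx i p) / 2 < loch i p < wave (locx i p)].

Lemma wave2B (x : R) j : wave (2 * (x - j%:~R)) = wave (2 * x).
Proof.
have -> : 2 * (x - j%:~R) = 2 * x - (2 * j)%:~R by rewrite intrM; ring.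
exact: waveB.
Qed.

Lemma tileP i j k p : (tile_map a b i j k @` hatP a b) p <-> in_tile i j k p.
Proof.
rewrite /hatP tile_sweepP; last exact: pentagon_gt0.
rewrite pentagonE /= in_itv /= wave2B waveB.
by split=> [[hy [hx hh]]|[hx hy hh]]; repeat split => //; lra.
Qed.

End Tile.

(** * Order of the levels above a fixed abscissa *)

Section Levels.
Context {R : realType} (a b : R).
Implicit Types (x : R) (i : int) (p : Sol a b).

(** Common boundary of the levels [i] and [i + 1], in the height [expR (a * z)] without rescaling,
    so that different levels can be compared at the same point. *)
Definition crest i x : R := 2 ^ i * wave (x / 2 ^ i).

Lemma crest_ge i x : 2 ^ (i + 1) <= crest i x.
Proof. by rewrite /crest expfzDr // ler_pM2l ?exprz_gt0 // expr1z wave_ge. Qed.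

Lemma crest_lt i x : crest i x < 2 ^ (i + 2).
Proof.
rewrite /crest expfzDr // ltr_pM2l ?exprz_gt0 //.
by rewrite (_ : 2 ^ 2 = 4 :> R) ?wave_lt // -exprnP; ring.
Qed.

(** The ranges are separated by powers of 2: [crest i < 2 ^ (i + 2) <= 2 ^ (i' + 1) <= crest i']. *)
Lemma crest_homo x : {homo (fun i => crest i x) : i i' / i < i'}.
Proof.
move=> i i' ii'; apply: lt_le_trans (crest_lt _ _) (le_trans _ (crest_ge _ _)).
by rewrite ler_weXz2l ?ler1n //; lia.
Qed.

Lemma locxS i p : locx (i + 1) p = locx i p / 2.
Proof. by rewrite /locx expfzDr // expr1z; field; rewrite expfz_neq0. Qed.

Lemma lochS i p : loch (i + 1) p = loch i p / 2.
Proof. by rewrite /loch expfzDr // expr1z; field; rewrite expfz_neq0. Qed.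

Lemma locyS n i p : (0 < n)%N -> locy n (i + 1) p = n%:R * locy n i p.
Proof.
move=> n0; rewrite /locy expfzDr ?expr1z ?pnatr_eq0 -?lt0n //; ring.
Qed.

Lemma wave_crest i p : wave (locx i p) = crest i p.1.1 / 2 ^ i.
Proof. by rewrite /crest /locx; field; rewrite expfz_neq0. Qed.

(** Doubling [locx i] gives [locx (i - 1)], so the bottom of a level is the top of the previous
    one. *)
Lemma wave2_crest i p : wave (2 * locx i p) / 2 = crest (i - 1) p.1.1 / 2 ^ i.
Proof.
have E : 2 * locx i p = locx (i - 1) p.
  by rewrite -{1}[i](subrK 1) locxS mulrC divfK.
have -> : 2 ^ i = 2 ^ (i - 1) * 2 :> R.
  by rewrite -{1}[i](subrK 1) expfzDr // expr1z.
by rewrite E wave_crest; field; rewrite expfz_neq0.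
Qed.

Lemma level_lt i p :
  (wave (2 * locx i p) / 2 < loch i p < wave (locx i p)) =
  (crest (i - 1) p.1.1 < expR (a * p.2) < crest i p.1.1).
Proof.
by rewrite wave2_crest wave_crest /loch !ltr_pM2r ?invr_gt0 ?exprz_gt0.
Qed.

Lemma level_le i p :
  (wave (2 * locx i p) / 2 <= loch i p <= wave (locx i p)) =
  (crest (i - 1) p.1.1 <= expR (a * p.2) <= crest i p.1.1).
Proof.
by rewrite wave2_crest wave_crest /loch !ler_pM2r ?invr_gt0 ?exprz_gt0.
Qed.

Lemma level_eq_top i p :
  loch i p = wave (locx i p) <-> expR (a * p.2) = crest i p.1.1.
Proof.
rewrite wave_crest /loch; split=> [|-> //].
by apply: mulIf; rewrite invr_eq0 expfz_neq0.
Qed.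

Lemma level_eq_bot i p :
  loch i p = wave (2 * locx i p) / 2 <-> expR (a * p.2) = crest (i - 1) p.1.1.
Proof.
rewrite wave2_crest /loch; split=> [|-> //].
by apply: mulIf; rewrite invr_eq0 expfz_neq0.
Qed.

(** By monotonicity of the crests, a different level would have its top at or below [crest (i - 1)],
    or its bottom at or above [crest i]. *)
Lemma level_uniq i i' p :
  wave (2 * locx i p) / 2 < loch i p < wave (locx i p) ->
  wave (2 * locx i' p) / 2 <= loch i' p <= wave (locx i' p) -> i' = i.
Proof.
rewrite level_lt level_le => /andP[l1 u1] /andP[l2 u2].
have [ii'|ii'|//] := ltrgtP i' i.
  have : crest i' p.1.1 <= crest (i - 1) p.1.1.
    by apply: (ltW_homo (crest_homo _)); lia.
  by move=> ?; exfalso; lra.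
have : crest i p.1.1 <= crest (i' - 1) p.1.1.
  by apply: (ltW_homo (crest_homo _)); lia.
by move=> ?; exfalso; lra.
Qed.

Lemma level_top_uniq i i' p :
  loch i p = wave (locx i p) ->
  wave (2 * locx i' p) / 2 <= loch i' p <= wave (locx i' p) ->
  i' = i \/ i' = i + 1.
Proof.
rewrite level_eq_top level_le => -> /andP[l u].
have [lt1|/[dup] le1] := ltP i' i.
  by have := crest_homo p.1.1 lt1 => ?; exfalso; lra.
have [lt2|le2] := ltP (i + 1) i'; last by move=> _; lia.
have : crest i p.1.1 < crest (i' - 1) p.1.1 by apply: crest_homo; lia.
by move=> ?; exfalso; lra.
Qed.

Lemma level_bot_uniq i i' p :
  loch i p = wave (2 * locx i p) / 2 ->
  wave (2 * locx i' p) / 2 <= loch i' p <= wave (locx i' p) ->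
  i' = i \/ i = i' + 1.
Proof.
rewrite level_eq_bot -level_eq_top => e /(level_top_uniq e) []; lia.
Qed.

Lemma intr_itv_uniq (x : R) (m m' : int) :
  m%:~R < x < m%:~R + 1 -> m'%:~R <= x <= m'%:~R + 1 -> m' = m.
Proof.
move=> /andP[l u] /andP[l' u'].
have : (m%:~R : R) < (m' + 1)%:~R by rewrite intrD; lra.
have : (m'%:~R : R) < (m + 1)%:~R by rewrite intrD; lra.
by rewrite !ltr_int; lia.
Qed.

Lemma intr_end_uniq (x : R) (m m' : int) :
  x = m%:~R -> m'%:~R <= x <= m'%:~R + 1 -> m' = m \/ m' = m - 1.
Proof.
move=> -> /andP[l' u'].
have : (m%:~R : R) <= (m' + 1)%:~R by rewrite intrD; lra.
by move: l'; rewrite !ler_int; lia.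
Qed.

End Levels.

(** * Covering and disjointness of interiors *)

Section Tiling.
Context {R : realType} (a b : R) (n : nat).
Context (ha : 0 < a) (hn : (2 <= n)%N).
Context (hab : b / a = ln (n%:R : R) / ln (2 : R)).
Implicit Types (i j k : int) (p : Sol a b).

Let tileP := tileP ha hn hab.

Lemma in_tile_uniq i j k i' j' k' p :
  in_tile_strict n i j k p -> in_tile n i' j' k' p ->
  [/\ i' = i, j' = j & k' = k].
Proof.
move=> [hx hy hh] [hx' hy' hh'].
have E := level_uniq hh hh'; move: hx' hy'; rewrite E.
by move=> /(intr_itv_uniq hx) -> /(intr_itv_uniq hy) ->.
Qed.

Lemma tile_cover p : exists i j k, in_tile n i j k p.
Proof.
suff [i hi] : exists i, wave (2 * locx i p) / 2 <= loch i p <= wave (locx i p).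
  exists i, (Num.floor (locx i p)), (Num.floor (locy n i p)).
  by split=> //; rewrite -(intrD _ _ 1) floor_le ltW ?floorD1_gt.
have ln2 : 0 < ln (2 : R) by rewrite ln_gt0 // ltr1n.
(* With [2 ^ m <= expR (a * z) < 2 ^ (m + 1)], the height lies strictly between [crest (m - 2)] and
   [crest m]; comparison with [crest (m - 1)] chooses the level [m] or [m - 1]. *)
set m := Num.floor (a * p.2 / ln 2).
have lo : 2 ^ m <= expR (a * p.2).
  by rewrite -expR_intM_ln // ler_expR -ler_pdivlMr // floor_le.
have up : expR (a * p.2) < 2 ^ (m + 1).
  by rewrite -expR_intM_ln // ltr_expR -ltr_pdivrMr // floorD1_gt.
have [le|lt] := leP (crest (m - 1) p.1.1) (expR (a * p.2)).
  by exists m; rewrite level_le le (le_trans (ltW up)) ?crest_ge.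
exists (m - 1); rewrite level_le [X in _ && X]ltW // andbT.
apply: le_trans lo; apply/ltW; apply: lt_le_trans (crest_lt _ _) _.
by rewrite -addrA -addrA subrr addr0.
Qed.

(** Small moves in the four coordinate directions stay in the pentagon. Horizontal moves make the
    bounds on the abscissa strict; vertical moves keep the values of [wave] and make the height
    bounds strict. *)
Lemma pentagon_interior (w : R * R) : pentagon° w ->
  0 < w.1 < 1 /\ wave (2 * w.1) / 2 < w.2 < wave w.1.
Proof.
case: w => x y /nbhs_ballP [e /= e0 sub].
have H c d : `|c| < e -> `|d| < e -> pentagon (x + c, y + d).
  by move=> ce de; apply: sub; split; rewrite /= /ball /= opprD addrA subrr sub0r normrN.
have ne : `|0 : R| < e by rewrite normr0.
have pe : `|e / 2| < e by rewrite gtr0_norm; lra.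
have me : `|- (e / 2)| < e by rewrite normrN.
have := (H _ _ pe ne, H _ _ me ne, H _ _ ne pe, H _ _ ne me).
rewrite !addr0 => -[[[/pentagonE/= [? _] /pentagonE/= [? _]]]].
by move=> /pentagonE/= [_ ?] /pentagonE/= [_ ?]; split; lra.
Qed.

Lemma tile_interior i j k p :
  (tile_map a b i j k @` hatP a b)° p -> in_tile_strict n i j k p.
Proof.
case: p => [[x y] z] ip.
(* The topology of [Sol a b] is that of the product; with the type made explicit, product balls
   become available. *)
have {ip} : nbhs ((x, y, z) : (R * R * R)%type)
  (tile_map a b i j k @` hatP a b : set (R * R * R)) by [].
move=> /nbhs_ballP [e /= e0 sub].
have bd (c d : R) : `|c| < e -> ball d e (d + c).
  by rewrite /ball /= opprD addrA subrr sub0r normrN.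
have H c d f : `|c| < e -> `|d| < e -> `|f| < e ->
    in_tile n i j k ((x + c, y + d, z + f) : Sol a b).
  by move=> ce de fe; apply/tileP/sub; split; [split|]; apply: bd.
have ne : `|0 : R| < e by rewrite normr0.
have pe : `|e / 2| < e by rewrite gtr0_norm; lra.
have me : `|- (e / 2)| < e by rewrite normrN.
have := (H _ _ _ pe ne ne, H _ _ _ me ne ne, H _ _ _ ne pe ne,
  H _ _ _ ne me ne, H _ _ _ ne ne pe, H _ _ _ ne ne me).
rewrite !addr0 => -[[[[[[+ _ _] [+ _ _]] [_ + _]] [_ + _]] [_ _ +]] [_ _ +]].
have P2 : 0 < (2 ^ i)^-1 :> R by rewrite invr_gt0 exprz_gt0.
have PN : 0 < n%:R ^ i :> R by rewrite exprz_gt0 // ltr0n ltnW.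
have e2 : e / 2 > 0 by lra.
have f1 := mulr_gt0 e2 P2; have f2 := mulr_gt0 e2 PN.
have f3 : expR (a * (z + - (e / 2))) / 2 ^ i < expR (a * z) / 2 ^ i.
  by rewrite ltr_pM2r // ltr_expR ltr_pM2l //; lra.
have f4 : expR (a * z) / 2 ^ i < expR (a * (z + e / 2)) / 2 ^ i.
  by rewrite ltr_pM2r // ltr_expR ltr_pM2l //; lra.
rewrite /in_tile_strict /locx /locy /loch /= !mulrDl !mulNr => *.
by split; lra.
Qed.

Lemma hatT_tiling : is_tiling (hatT a b).
Proof.
split.
  apply/seteqP; split=> // p _.
  have [i [j [k h]]] := tile_cover p.
  by exists (tile_map a b i j k @` hatP a b); [exists i, j, k|apply/tileP].
move=> t1 t2 [i [j [k ->]]] [i' [j' [k' ->]]] neq.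
apply/seteqP; split=> // p [/tile_interior h1 h2]; apply: neq.
have /tileP h3 := interior_subset h2.
by have [-> -> ->] := in_tile_uniq h1 h3.
Qed.

End Tiling.

(** * Common faces of neighbouring tiles *)

Lemma int_divn (n : nat) (k : int) : (0 < n)%N ->
  exists k' (l : 'I_n), k = n%:Z * k' + l%:Z.
Proof.
move=> n_gt0; have n0 : n%:Z != 0 by lia.
have np : 0 < n%:Z by lia.
have := modz_ge0 k n0; have := ltz_pmod k np; have := divz_eq k n%:Z.
case: (k %% n%:Z)%Z => // l e ln _; have ln' : (l < n)%N by lia.
by exists (k %/ n%:Z)%Z, (Ordinal ln'); rewrite [LHS]e /=; lia.
Qed.

Lemma int_parity (j : int) : exists j', j = 2 * j' \/ j = 2 * j' + 1.
Proof.
exists (j %/ 2)%Z; have := divz_eq j 2; have := ltz_pmod j (isT : 0 < 2 :> int).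
have := modz_ge0 j (isT : 2 != 0 :> int); lia.
Qed.

Section Faces.
Context {R : realType} (a b : R) (n : nat).
Context (ha : 0 < a) (hn : (2 <= n)%N).
Context (hab : b / a = ln (n%:R : R) / ln (2 : R)).
Implicit Types (i j k : int) (p : Sol a b) (f : face_index n).

Let tileP := tileP ha hn hab.
Let tile_sweepP := tile_sweepP ha hn hab.

Definition level_band i p : bool :=
  wave (2 * locx i p) / 2 <= loch i p <= wave (locx i p).
Definition level_band_strict i p : bool :=
  wave (2 * locx i p) / 2 < loch i p < wave (locx i p).

Definition in_face i j k f p : Prop :=
  match f with
  | FLeft => [/\ locx i p = j%:~R, k%:~R <= locy n i p <= k%:~R + 1 & level_band i p]
  | FRight =>
      [/\ locx i p = j%:~R + 1, k%:~R <= locy n i p <= k%:~R + 1 & level_band i p]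
  | FBotL => [/\ j%:~R <= locx i p <= j%:~R + 2^-1,
      k%:~R <= locy n i p <= k%:~R + 1 & loch i p = wave (2 * locx i p) / 2]
  | FBotR => [/\ j%:~R + 2^-1 <= locx i p <= j%:~R + 1,
      k%:~R <= locy n i p <= k%:~R + 1 & loch i p = wave (2 * locx i p) / 2]
  | FFront =>
      [/\ j%:~R <= locx i p <= j%:~R + 1, locy n i p = k%:~R & level_band i p]
  | FBack =>
      [/\ j%:~R <= locx i p <= j%:~R + 1, locy n i p = k%:~R + 1 & level_band i p]
  | FTop l => [/\ j%:~R <= locx i p <= j%:~R + 1,
      k%:~R + l%:R / n%:R <= locy n i p <= k%:~R + l.+1%:R / n%:R
      & loch i p = wave (locx i p)]
  end.

(** The one equation names the wall carrying the face; the strict conditions will determine the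
    remaining indices of any tile through the point. *)
Definition in_open_face i j k f p : Prop :=
  match f with
  | FLeft =>
      [/\ locx i p = j%:~R, k%:~R < locy n i p < k%:~R + 1 & level_band_strict i p]
  | FRight =>
      [/\ locx i p = j%:~R + 1, k%:~R < locy n i p < k%:~R + 1 & level_band_strict i p]
  | FBotL => [/\ j%:~R < locx i p < j%:~R + 2^-1,
      k%:~R < locy n i p < k%:~R + 1 & loch i p = wave (2 * locx i p) / 2]
  | FBotR => [/\ j%:~R + 2^-1 < locx i p < j%:~R + 1,
      k%:~R < locy n i p < k%:~R + 1 & loch i p = wave (2 * locx i p) / 2]
  | FFront =>
      [/\ j%:~R < locx i p < j%:~R + 1, locy n i p = k%:~R & level_band_strict i p]
  | FBack =>
      [/\ j%:~R < locx i p < j%:~R + 1, locy n i p = k%:~R + 1 & level_band_strict i p]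
  | FTop l => [/\ j%:~R < locx i p < j%:~R + 1,
      k%:~R + l%:R / n%:R < locy n i p < k%:~R + l.+1%:R / n%:R
      & loch i p = wave (locx i p)]
  end.

Lemma sweep_pt (s : R) (V : set (R * R)) :
  ltrans (elT a b s) @` (half_plane_emb a b @` V) = sweep a b [set s] V.
Proof. by rewrite /sweep bigcup_set1. Qed.

Lemma sweep0 (V : set (R * R)) : half_plane_emb a b @` V = sweep a b [set 0] V.
Proof.
rewrite -sweep_pt; apply/seteqP; split=> [p Vp|_ [p Vp <-]].
  exists p => //; rewrite /ltrans; exact: mul1g.
by rewrite /ltrans (_ : (elT a b 0 * p)%g = p) //; exact: mul1g.
Qed.

Let side_pos s : (side s : set (R * R)) `<=` [set w | 0 < w.2].
Proof. by move=> w /side_sub_pentagon/pentagon_gt0. Qed.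

Let open_side_pos s : (open_side s : set (R * R)) `<=` [set w | 0 < w.2].
Proof. by move=> w [/side_pos]. Qed.

Let pentagon_pos : (pentagon : set (R * R)) `<=` [set w | 0 < w.2].
Proof. exact: pentagon_gt0. Qed.

Let pentagono_pos : (pentagon° : set (R * R)) `<=` [set w | 0 < w.2].
Proof. by move=> w /interior_subset/pentagon_pos. Qed.

Lemma faceP i j k f p :
  (tile_map a b i j k @` face a b f) p <-> in_face i j k f p.
Proof.
case: f => [||||||l]; rewrite /face ?sweep_pt ?sweep0 tile_sweepP //
  ?sideE ?pentagonE /= ?in_itv /= ?wave2B ?waveB /level_band;
  (split=> [[hy [hx hh]]|[hx hy hh]]; repeat split=> //; lra).
Qed.

Lemma face_relintP i j k f p :
  (tile_map a b i j k @` face_relint a b f) p -> in_open_face i j k f p.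
Proof.
by case: f => [||||||l]; rewrite /face_relint ?sweep_pt ?sweep0 tile_sweepP //;
  case=> hy; first [move/open_sideE|move/pentagon_interior]; move: hy;
  rewrite /= ?in_itv /= ?wave2B ?waveB /level_band_strict => hy [hx hh];
  split=> //; lra.
Qed.

Let n_gt0 : 0 < n%:R :> R. Proof. by rewrite ltr0n ltnW. Qed.

(** Multiplication by [n], the passage from [locy n i] to [locy n (i + 1)], turns the part of index
    [l] of a unit interval into the unit interval at [n * k + l]. *)
Let sub_itv (k : int) (l : nat) (y : R) :
  (k%:~R + l%:R / n%:R <= y <= k%:~R + l.+1%:R / n%:R) =
  ((n%:Z * k + l%:Z)%:~R <= n%:R * y <= (n%:Z * k + l%:Z)%:~R + 1).
Proof.
rewrite -(ler_pM2l n_gt0) -[y <= _](ler_pM2l n_gt0) !mulrDr.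
rewrite ![n%:R * (_ / _)]mulrC !divfK ?gt_eqF //.
by rewrite !(intrD, intrM) -!pmulrn -[l.+1]addn1 natrD !addrA.
Qed.

Let sub_itv_lt (k : int) (l : nat) (y : R) :
  (k%:~R + l%:R / n%:R < y < k%:~R + l.+1%:R / n%:R) =
  ((n%:Z * k + l%:Z)%:~R < n%:R * y < (n%:Z * k + l%:Z)%:~R + 1).
Proof.
rewrite -(ltr_pM2l n_gt0) -[y < _](ltr_pM2l n_gt0) !mulrDr.
rewrite ![n%:R * (_ / _)]mulrC !divfK ?gt_eqF //.
by rewrite !(intrD, intrM) -!pmulrn -[l.+1]addn1 natrD !addrA.
Qed.

Let half_double (x : R) : 2 * (x / 2) = x. Proof. by rewrite mulrC divfK. Qed.

Let eq_face i j k f i' j' k' f' :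
  (forall p, in_face i j k f p <-> in_face i' j' k' f' p) ->
  tile_map a b i j k @` face a b f = tile_map a b i' j' k' @` face a b f'.
Proof. by move=> h; apply/seteqP; split=> p /faceP/h/faceP. Qed.

Let sub_itv_sub (k : int) (l : 'I_n) (y : R) :
  k%:~R + l%:R / n%:R < y < k%:~R + l.+1%:R / n%:R -> k%:~R < y < k%:~R + 1.
Proof.
have l0 : 0 <= l%:R / n%:R :> R by rewrite divr_ge0.
have l1 : l.+1%:R / n%:R <= 1 :> R by rewrite ler_pdivrMr // mul1r ler_nat.
lra.
Qed.

(* A top face sits on the left or right bottom face of a tile one level up,
   according to the parity of its horizontal index. *)
Lemma face_top_botL i j k (l : 'I_n) :
  tile_map a b i (2 * j) k @` face a b (FTop l) =
  tile_map a b (i + 1) j (n%:Z * k + l%:Z) @` face a b (@FBotL n).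
Proof.
apply: eq_face => p; rewrite /in_face.
rewrite (sub_itv k l) locxS lochS locyS ?(ltnW hn) // half_double (intrM _ 2 j).
by split=> -[? ? ?]; split=> //; lra.
Qed.

Lemma face_top_botR i j k (l : 'I_n) :
  tile_map a b i (2 * j + 1) k @` face a b (FTop l) =
  tile_map a b (i + 1) j (n%:Z * k + l%:Z) @` face a b (@FBotR n).
Proof.
apply: eq_face => p; rewrite /in_face.
rewrite (sub_itv k l) locxS lochS locyS ?(ltnW hn) // half_double.
rewrite (intrD _ (2 * j) 1) (intrM _ 2 j).
by split=> -[? ? ?]; split=> //; lra.
Qed.

Lemma face_left_right i j k :
  tile_map a b i j k @` face a b (@FLeft n) =
  tile_map a b i (j - 1) k @` face a b (@FRight n).
Proof.
by apply: eq_face => p; rewrite /in_face intrB subrK.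
Qed.

Lemma face_front_back i j k :
  tile_map a b i j k @` face a b (@FFront n) =
  tile_map a b i j (k - 1) @` face a b (@FBack n).
Proof.
by apply: eq_face => p; rewrite /in_face intrB subrK.
Qed.

(** Strict conditions fix their indices, and the equation leaves two choices: the same tile, or the
    neighbour across that wall. In the latter case the face is rewritten as a face of the
    neighbour. *)
Lemma in_tile_open_face i j k f i' j' k' p :
  in_open_face i j k f p -> in_tile n i' j' k' p ->
  [/\ i' = i, j' = j & k' = k] \/ exists f',
    tile_map a b i j k @` face a b f = tile_map a b i' j' k' @` face a b f'.
Proof.
move=> + [hx' hy' hh']; have n0 := ltnW hn.
case: f => [||||||l] [hx hy hh].
- have ei := level_uniq hh hh'; rewrite ei in hx' hy' *.
  rewrite (intr_itv_uniq hy hy').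
  have [-> | ->] := intr_end_uniq hx hx'; first by left.
  by right; exists (@FRight n); rewrite face_left_right.
- have ei := level_uniq hh hh'; rewrite ei in hx' hy' *.
  rewrite (intr_itv_uniq hy hy').
  have hx1 : locx i p = (j + 1)%:~R by rewrite intrD.
  have [-> | ->] := intr_end_uniq hx1 hx'; last by left; rewrite addrK.
  by right; exists (@FLeft n); rewrite face_left_right addrK.
(* In the second case the other tile is one level below. The left half of column [j] is column
   [2 * j] there, and division of [k] by [n] gives the third index of that tile and the number [l]
   of its top face. *)
- have [ei | ei] := level_bot_uniq hh hh'.
    rewrite ei in hx' hy' *; left; split=> //.
      by apply: (intr_itv_uniq _ hx'); lra.
    exact: intr_itv_uniq hy hy'.
  move: hx hy hh; rewrite ei => hx hy hh; right.
  have [kk [l ek]] := int_divn k n0.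
  have hx1 : (2 * j)%:~R < locx i' p < (2 * j)%:~R + 1.
    by move: hx; rewrite locxS (intrM _ 2 j); lra.
  have hy1 : kk%:~R < locy n i' p < kk%:~R + 1.
    by apply: (@sub_itv_sub _ l); rewrite sub_itv_lt -ek -locyS.
  rewrite (intr_itv_uniq hx1 hx') (intr_itv_uniq hy1 hy').
  by exists (FTop l); rewrite ek face_top_botL.
- have [ei | ei] := level_bot_uniq hh hh'.
    rewrite ei in hx' hy' *; left; split=> //.
      by apply: (intr_itv_uniq _ hx'); lra.
    exact: intr_itv_uniq hy hy'.
  move: hx hy hh; rewrite ei => hx hy hh; right.
  have [kk [l ek]] := int_divn k n0.
  have hx1 : (2 * j + 1)%:~R < locx i' p < (2 * j + 1)%:~R + 1.
    by move: hx; rewrite locxS (intrD _ (2 * j) 1) (intrM _ 2 j); lra.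
  have hy1 : kk%:~R < locy n i' p < kk%:~R + 1.
    by apply: (@sub_itv_sub _ l); rewrite sub_itv_lt -ek -locyS.
  rewrite (intr_itv_uniq hx1 hx') (intr_itv_uniq hy1 hy').
  by exists (FTop l); rewrite ek face_top_botR.
- have ei := level_uniq hh hh'; rewrite ei in hx' hy' *.
  rewrite (intr_itv_uniq hx hx').
  have [-> | ->] := intr_end_uniq hy hy'; first by left.
  by right; exists (@FBack n); rewrite face_front_back.
- have ei := level_uniq hh hh'; rewrite ei in hx' hy' *.
  rewrite (intr_itv_uniq hx hx').
  have hy1 : locy n i p = (k + 1)%:~R by rewrite intrD.
  have [-> | ->] := intr_end_uniq hy1 hy'; last by left; rewrite addrK.
  by right; exists (@FFront n); rewrite face_front_back addrK.
- have [ei | ei] := level_top_uniq hh hh'.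
    rewrite ei in hx' hy' *; left; split=> //; first exact: intr_itv_uniq hx hx'.
    exact: intr_itv_uniq (sub_itv_sub hy) hy'.
  rewrite ei in hx' hy' *; right.
  rewrite sub_itv_lt -locyS // in hy; rewrite (intr_itv_uniq hy hy').
  (* One level up, columns merge in pairs: the parity of [j] tells which bottom side of the upper
     tile is met. *)
  have [jj [ej | ej]] := int_parity j.
    have hx1 : jj%:~R < locx (i + 1) p < jj%:~R + 1.
      by move: hx; rewrite locxS ej (intrM _ 2 jj); lra.
    rewrite (intr_itv_uniq hx1 hx') ej.
    by exists (@FBotL n); rewrite face_top_botL.
  have hx1 : jj%:~R < locx (i + 1) p < jj%:~R + 1.
    by move: hx; rewrite locxS ej (intrD _ (2 * jj) 1) (intrM _ 2 jj); lra.
  rewrite (intr_itv_uniq hx1 hx') ej.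
  by exists (@FBotR n); rewrite face_top_botR.
Qed.

Lemma hatT_face_to_face : face_to_face a b n.
Proof.
move=> t1 t2 _ [i' [j' [k' e2]]] neq F p _.
rewrite e2 => /tileP h2 [i [j [k [f [e1 eF /face_relintP h1]]]]].
rewrite -e2; split; first by exists i, j, k, f.
have [[ei ej ek] | [f' e']] := in_tile_open_face h1 h2.
  by case: neq; rewrite e1 e2 ei ej ek.
by exists i', j', k', f'; rewrite eF.
Qed.

End Faces.

(** * Upper bounds for the Riemannian distance *)

Section Distance.
Context {R : realType} (a b : R).
Implicit Types (p q g : Sol a b).

Definition affine_arc p (dx dy dz : R) : R -> Sol a b :=
  fun t => (p.1.1 + t * dx, p.1.2 + t * dy, p.2 + t * dz).

Lemma is_derive_affine (u v t : R) : is_derive t 1 (fun t : R => u + t * v) v.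
Proof.
by apply: is_derive_eq; rewrite scaler0 !add0r /GRing.scale /= mulr1 mul1r.
Qed.

Lemma derive1_affine (u v : R) : derive1 (fun t : R => u + t * v) = cst v.
Proof.
apply/funext => t; rewrite derive1E.
by rewrite (@derive_val _ _ _ _ _ _ _ (is_derive_affine u v t)).
Qed.

Lemma C1_affine (u v : R) : C1 (fun t : R => u + t * v).
Proof.
split; last by rewrite derive1_affine; exact: cst_continuous.
by move=> t; have [] := is_derive_affine u v t.
Qed.

Lemma C1_affine_arc p (dx dy dz : R) : C1_arc (affine_arc p dx dy dz).
Proof. by split; exact: C1_affine. Qed.

Lemma arc_length_affine p (dx dy dz l : R) :
  (forall t, tangent_norm (affine_arc p dx dy dz t) dx dy dz = l) ->
  arc_length (affine_arc p dx dy dz) = l.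
Proof.
move=> h; rewrite /arc_length /= !derive1_affine.
under eq_Rintegral do rewrite h.
by rewrite Rintegral_cst //= lebesgue_measure_itv /= lte01 sube0 mulr1.
Qed.

(** Bounds the lengths from below, so that the infimum [sol_dist] is at most the length of any given
    path. *)
Lemma pw_path_ge0 p q (L : R) : pw_path p q L -> 0 <= L.
Proof.
elim=> // c r l _ _ l0; rewrite addr_ge0 // /arc_length.
by apply: Rintegral_ge0 => t _; exact: sqrtr_ge0.
Qed.

Lemma sqrtrD_le (x y : R) : 0 <= x -> 0 <= y ->
  Num.sqrt (x ^+ 2 + y ^+ 2) <= x + y.
Proof.
move=> x0 y0; rewrite -[leRHS]ger0_norm ?addr_ge0 // -sqrtr_sqr ler_wsqrtr //.
by rewrite sqrrD lerD2r lerDl mulrn_wge0 // mulr_ge0.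
Qed.

(* The path first moves along the third axis, then within a horizontal plane,
   where the metric is constant. *)
Lemma sol_dist_le p q : sol_dist p q <=
  `|q.2 - p.2| + (expR (- (a * q.2)) * `|q.1.1 - p.1.1|
                  + expR (b * q.2) * `|q.1.2 - p.1.2|).
Proof.
set m : Sol a b := (p.1.1, p.1.2, q.2).
pose c1 := affine_arc p 0 0 (q.2 - p.2).
pose c2 := affine_arc m (q.1.1 - p.1.1) (q.1.2 - p.1.2) 0.
have E1 : arc_length c1 = `|q.2 - p.2|.
  apply: arc_length_affine => t.
  by rewrite /tangent_norm !expr0n !mulr0 !add0r sqrtr_sqr.
have E2 : arc_length c2 = Num.sqrt
    ((expR (- (a * q.2)) * `|q.1.1 - p.1.1|) ^+ 2
     + (expR (b * q.2) * `|q.1.2 - p.1.2|) ^+ 2).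
  apply: arc_length_affine => t.
  rewrite /tangent_norm /= !mulr0 !addr0 expr0n addr0 !exprMn !real_normK ?num_real //.
  by rewrite -!expRM_natl; congr (Num.sqrt (expR _ * _ + expR _ * _)); ring.
have P : pw_path p q (arc_length c1 + (arc_length c2 + 0)).
  have {1}-> : p = c1 0.
    by rewrite /c1 /affine_arc !mul0r !addr0 -!surjective_pairing.
  apply: pw_cons; first exact: C1_affine_arc.
  have -> : c1 1 = c2 0.
    by rewrite /c1 /c2 /affine_arc /= !mul0r !mul1r !addr0 addrC subrK.
  apply: pw_cons; first exact: C1_affine_arc.
  have -> : c2 1 = q; last exact: pw_nil.
  rewrite /c2 /affine_arc /= !mul1r addr0 ![_ + (_ - _)]addrC !subrK.
  by rewrite -!surjective_pairing.
apply: le_trans (ge_inf _ P) _.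
  by exists 0 => L /pw_path_ge0.
rewrite E1 E2 addr0 lerD2l sqrtrD_le // mulr_ge0 ?expR_ge0 //.
Qed.

(** The bound of [sol_dist_le] is itself left invariant: the factors by which [g] stretches the
    horizontal differences cancel against the weights at the new height. *)
Lemma sol_dist_mul_le g p q : sol_dist (g * p)%g (g * q)%g <=
  `|q.2 - p.2| + (expR (- (a * q.2)) * `|q.1.1 - p.1.1|
                  + expR (b * q.2) * `|q.1.2 - p.1.2|).
Proof.
apply: le_trans (sol_dist_le _ _) _; rewrite le_eqVlt; apply/orP; left; apply/eqP.
rewrite /= opprD addrACA subrr add0r; congr (_ + (_ + _)).
  rewrite opprD addrACA subrr add0r -mulrBr normrM mulrA; congr (_ * _).
  by rewrite gtr0_norm ?expR_gt0 // -expRD; congr expR; ring.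
rewrite opprD addrACA subrr add0r -mulrBr normrM mulrA; congr (_ * _).
by rewrite gtr0_norm ?expR_gt0 // -expRD; congr expR; ring.
Qed.

End Distance.

(** * The colouring of the levels *)

(* The parity of the 2-adic valuation: almost periodic, but without periods. *)
Definition colour (i : int) : bool := odd (logn 2 `|i|%N).

(** Comparing [i] with [2 * i], whose valuation is one larger, excludes a nonzero period. *)
Lemma colour_period_eq0 (i : int) : (forall i', colour (i + i') = colour i') -> i = 0.
Proof.
move=> h; apply/eqP/negPn/negP => i0.
have := h i; rewrite /colour (_ : `|(i + i)%R|%N = (2 * `|i|)%N); last by lia.
by rewrite lognM ?absz_gt0 // oddD logn_prime //=; case: (odd (logn 2 `|i|)).
Qed.

(** The powers [2 ^ f] with [f <= e] divide [m + i] exactly when they divide [i], and the size of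
    [i] keeps its valuation below [e]. *)
Lemma logn_absz_add (e : nat) (m i : int) :
  (2 ^ e %| `|m|)%N -> i != 0 -> (`|i| < 2 ^ e)%N ->
  logn 2 `|(m + i)%R| = logn 2 `|i|.
Proof.
move=> em i0 ie.
have dv f : (f <= e)%N -> (2 ^ f %| `|(m + i)%R|)%N = (2 ^ f %| `|i|)%N.
  move=> fe; have fm : ((2 ^ f)%N%:Z %| m)%Z.
    by rewrite dvdzE /=; apply: dvdn_trans em; rewrite dvdn_exp2l.
  have : ((2 ^ f)%N%:Z %| m + i)%Z = ((2 ^ f)%N%:Z %| i)%Z by apply: rpredDl.
  by rewrite !dvdzE.
have i_gt0 : (0 < `|i|)%N by rewrite absz_gt0.
have mi_gt0 : (0 < `|(m + i)%R|)%N.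
  rewrite lt0n; apply/eqP => mi0; have := dv e (leqnn e).
  by rewrite mi0 dvdn0 => /esym/(dvdn_leq i_gt0); rewrite leqNgt ie.
set v := logn 2 `|i|.
have ve : (v < e)%N.
  rewrite -(ltn_exp2l _ _ (ltnSn 1)); apply: leq_ltn_trans ie.
  by apply: dvdn_leq => //; rewrite pfactor_dvdn.
apply/eqP; rewrite eqn_leq; apply/andP; split.
  by rewrite leqNgt -pfactor_dvdn // dv // pfactor_dvdn // ltnn.
by rewrite -pfactor_dvdn // dv ?pfactor_dvdn // ltnW.
Qed.

Lemma colourD (M : nat) (t i : int) : (`|i| < 2 ^ (2 * M))%N ->
  colour (2 ^+ (2 * M) * (2 * t + 1) + i) = colour i.
Proof.
move=> iM; rewrite /colour; have [->|i0] := eqVneq i 0.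
  rewrite addr0 abszM abszX /= lognM ?expn_gt0 //; last by rewrite absz_gt0; lia.
  rewrite oddD lognX logn_prime //= muln1 oddM /=.
  by rewrite logn_coprime // coprime2n; lia.
by rewrite (@logn_absz_add (2 * M)) // abszM abszX dvdn_mulr.
Qed.

(** * Indices and colours of tiles, and the symmetries of the decorated tiling *)

Section Decoration.
Context {R : realType} (a b : R) (n : nat).
Context (ha : 0 < a) (hn : (2 <= n)%N).
Context (hab : b / a = ln (n%:R : R) / ln (2 : R)).
Implicit Types (i j k : int) (p g h : Sol a b).

Let tileP := tileP ha hn hab.
Let tile_mapE := tile_mapE ha hn hab.
Local Notation N := (n%:R : R).
Local Notation vertex := (@vertex R a b n).
Local Notation tile i j k := (tile_map a b i j k @` hatP a b).

Let N0 : 0 < N. Proof. by rewrite ltr0n ltnW. Qed.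
Let N_neq0 : N != 0. Proof. exact: lt0r_neq0. Qed.

Lemma vertex0 : vertex 0 0 0 = 1%g.
Proof. by rewrite /vertex /level !mul0r mulr0. Qed.

Lemma hatPP p : hatP a b p <-> [/\ 0 <= p.1.1 <= 1, 0 <= p.1.2 <= 1 &
  wave (2 * p.1.1) / 2 <= expR (a * p.2) <= wave p.1.1].
Proof.
have -> : hatP a b = tile 0 0 0.
  rewrite tile_mapE vertex0; apply/seteqP; split=> [q Pq|_ [q Pq <-]].
    by exists q => //; exact: mul1g.
  by rewrite /ltrans mul1g.
by rewrite tileP /in_tile /locx /locy /loch expr0z invr1 !mulr1 !add0r.
Qed.

Lemma hatP_box p : hatP a b p ->
  [/\ 0 <= p.1.1 <= 1, 0 <= p.1.2 <= 1 & 0 <= p.2 <= ln 4 / a].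
Proof.
move=> /hatPP [hx hy /andP[lo up]]; split=> //; apply/andP; split.
  rewrite -(pmulr_rge0 _ ha) -ler_expR expR0.
  by have := wave_ge (2 * p.1.1); lra.
rewrite ler_pdivlMr // mulrC -ler_expR lnK ?posrE //.
by have := wave_lt p.1.1; lra.
Qed.

Lemma ltransM g h (A : set (Sol a b)) :
  ltrans g @` (ltrans h @` A) = ltrans (g * h)%g @` A.
Proof.
rewrite image_comp; congr image; apply/funext => p.
by rewrite /ltrans /= mulgA.
Qed.

Lemma ltrans1 (A : set (Sol a b)) : ltrans 1%g @` A = A.
Proof.
apply/seteqP; split=> [_ [p Ap <-]|p Ap]; first by rewrite /ltrans mul1g.
by exists p => //; exact: mul1g.
Qed.

(** Only the bounding box matters: the images of the origin under [g] and its inverse force the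
    height of [g] to be 0, and then the images of two further corners leave no room for a horizontal
    shift. *)
Lemma hatP_stab g : ltrans g @` hatP a b = hatP a b -> g = 1%g.
Proof.
move=> E.
have E' : ltrans g^-1%g @` hatP a b = hatP a b.
  by rewrite -{1}E ltransM mulVg ltrans1.
have W0 : wave (0 : R) = 2 := wave_int 0.
have W2 : wave (2 : R) = 2 := wave_int 2.
have W1 : wave (1 : R) = 2 := wave_int 1.
have P0 : hatP a b (0, 0, 0).
  by apply/hatPP; rewrite /= !mulr0 expR0 W0; split; lra.
have P1 : hatP a b (1, 0, 0).
  by apply/hatPP; rewrite /= mulr0 mulr1 expR0 W1 W2; split; lra.
have P2 : hatP a b (0, 1, 0).
  by apply/hatPP; rewrite /= !mulr0 expR0 W0; split; lra.
have H p : hatP a b p -> hatP a b (g * p)%g by move=> Pp; rewrite -E; exists p.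
have H' p : hatP a b p -> hatP a b (g^-1 * p)%g by move=> Pp; rewrite -E'; exists p.
have := (hatP_box (H _ P0), hatP_box (H _ P1), hatP_box (H _ P2), hatP_box (H' _ P0)).
rewrite /= !mulr0 !mulr1 !addr0 => -[[[[x0 y0 z0] [x1 _ _]] [_ y1 _]] [_ _ z1]].
have z : g.2 = 0 by lra.
move: x1 y1; rewrite z !mulr0 expR0 => x1 y1.
rewrite [g]surjective_pairing [g.1]surjective_pairing z.
by congr (_, _, _); lra.
Qed.

Lemma ltrans_hatP_inj g h : ltrans g @` hatP a b = ltrans h @` hatP a b -> g = h.
Proof.
move=> E; suff : (h^-1 * g)%g = 1%g by move/(canRL (mulVKg _)); rewrite mulg1.
by apply: hatP_stab; rewrite -ltransM E ltransM mulVg ltrans1.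
Qed.

(** Moving a translation of index [(0, j, k)] past the level shift [i'] replaces [j] by [j / 2 ^ i']
    and [k] by [k * n ^ i']; the product is a vertex once the sums are integers. *)
Lemma vertexM (i j k i' j' k' j'' k'' : int) :
  j''%:~R = j'%:~R + j%:~R / 2 ^ i' :> R ->
  k''%:~R = k'%:~R + k%:~R * N ^ i' ->
  (vertex i j k * vertex i' j' k')%g = vertex (i + i') j'' k''.
Proof.
move=> ej ek; have P2 m : 2 ^ m != 0 :> R by rewrite expfz_neq0.
have PN m : N ^ m != 0 by rewrite expfz_neq0.
congr (_, _, _) => /=.
- rewrite (expR_level ha) ej expfzDr //; field; exact: P2.
- by rewrite (expR_levelN ha hn hab) ek expfzDr //; field; rewrite !PN.
- by rewrite /level intrD mulrDl.
Qed.

Lemma vertexM_inv i j k i' j' k' i'' j'' k'' :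
  (vertex i j k * vertex i' j' k')%g = vertex i'' j'' k'' ->
  [/\ i'' = i + i', j''%:~R = j'%:~R + j%:~R / 2 ^ i' :> R &
      k''%:~R = k'%:~R + k%:~R * N ^ i'].
Proof.
have P2 m : 2 ^ m != 0 :> R by rewrite expfz_neq0.
have PN m : N ^ m != 0 by rewrite expfz_neq0.
have l2 : ln (2 : R) / a != 0.
  by rewrite mulf_neq0 ?invr_eq0 ?gt_eqF // ln_gt0 // ltr1n.
move=> -[/=]; rewrite (expR_level ha) (expR_levelN ha hn hab) => ex ey ez.
have ei : i'' = i + i'.
  by move: ez; rewrite /level -mulrDl -intrD => /(mulIf l2)/intr_inj.
move: ex ey; rewrite ei !expfzDr // => ex ey; split=> //.
- apply: (mulfI (P2 i)); apply: (mulfI (P2 i')).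
  by rewrite mulrA [_ * 2 ^ i]mulrC -ex; field; exact: P2.
- have -> : k''%:~R = k''%:~R / (N ^ i * N ^ i') * N ^ i * N ^ i'.
    by field; rewrite !PN.
  by rewrite -ey; field; rewrite !PN.
Qed.

Lemma vertex_inj i j k i' j' k' :
  vertex i j k = vertex i' j' k' -> [/\ i = i', j = j' & k = k'].
Proof.
move=> E; have := @vertexM_inv 0 0 0 i j k i' j' k'.
rewrite vertex0 mul1g => /(_ E) [-> + +].
rewrite !mul0r !addr0 add0r => /intr_inj -> /intr_inj -> //.
Qed.

Lemma tile_act_tile g i j k :
  tile_act a b g (tile i j k) = ltrans (g * vertex i j k)%g @` hatP a b.
Proof. by rewrite /tile_act tile_mapE ltransM. Qed.

Lemma tile_inj i j k i' j' k' :
  tile i j k = tile i' j' k' -> [/\ i = i', j = j' & k = k'].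
Proof. by rewrite !tile_mapE => /ltrans_hatP_inj/vertex_inj. Qed.

(** Labels are attached to sets, so the level is recovered by an existential; [tile_inj] makes the
    result independent of the choice. *)
Definition tile_colour (t : set (Sol a b)) : bool :=
  `[< exists i j k, t = tile i j k /\ colour i >].

Lemma tile_colourE i j k : tile_colour (tile i j k) = colour i.
Proof.
apply/asboolP/idP => [[i' [j' [k' [/tile_inj [-> _ _]]]]] //|ci].
by exists i, j, k.
Qed.

Lemma decorated_aperiodic :
  aperiodic (dtile_act a b bool) (decorate (hatT a b) tile_colour).
Proof.
move=> g E.
have H i j k : exists i' j' k',
    (g * vertex i j k)%g = vertex i' j' k' /\ colour i' = colour i.
  have : decorate (hatT a b) tile_colour
      (dtile_act a b bool g (tile i j k, colour i)).
    rewrite -E; exists (tile i j k, colour i) => //.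
    by exists (tile i j k); [exists i, j, k|rewrite tile_colourE].
  move=> [_ [i' [j' [k' ->]]] []]; rewrite tile_colourE tile_act_tile.
  by rewrite tile_mapE => /ltrans_hatP_inj <- <-; exists i', j', k'.
(* The base tile has vertex 1, so [g] is itself a vertex. *)
have [i [j [k []]]] := H 0 0 0; rewrite vertex0 mulg1 => gE _; rewrite gE in H *.
have i0 : i = 0.
  apply: colour_period_eq0 => i'; have [i'' [j'' [k'' []]]] := H i' 0 0.
  by move=> /vertexM_inv [-> _ _].
have Hj i' : exists m : int, j%:~R = m%:~R * 2 ^ i' :> R.
  have [i'' [j'' [k'' []]]] := H i' 0 0.
  move=> /vertexM_inv [_ e _] _; exists j''.
  by rewrite e add0r divfK // expfz_neq0.
have Hk i' : exists m : int, k%:~R * N ^ i' = m%:~R.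
  have [i'' [j'' [k'' []]]] := H i' 0 0.
  by move=> /vertexM_inv [_ _ e] _; exists k''; rewrite e add0r.
rewrite i0.
have dvd0 (d : nat) (m : int) : (1 < d)%N ->
    (forall e : nat, exists m' : int, m = m' * (d ^ e)%N%:Z) -> m = 0.
  move=> d1 hd; apply/eqP/negPn/negP => m0.
  have [m' em] := hd `|m|%N.
  have : (d ^ `|m| %| `|m|)%N by rewrite {2}em abszM dvdn_mull.
  (* A nonzero [m] cannot be divisible by [d ^ |m|], which exceeds [|m|]. *)
  by move=> /dvdn_leq; rewrite absz_gt0 => /(_ m0); rewrite leqNgt ltn_expl.
suff [-> ->] : j = 0 /\ k = 0 by exact: vertex0.
split.
  apply: (@dvd0 2) => // e; have [m em] := Hj e; exists m.
  apply: (@intr_inj R); rewrite em intrM; congr (_ * _).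
  by rewrite -pmulrn natrX.
(* Divisibility of [k] comes from negative levels, where [k * n ^ (- e)] must be an integer. *)
apply: (@dvd0 n) => // e; have [m em] := Hk (- e%:Z); exists m.
apply: (@intr_inj R); rewrite intrM -em -pmulrn natrX -exprnN mulfVK //.
by rewrite expf_neq0.
Qed.

End Decoration.

(** * Repetitivity *)

Lemma finite_set_uniform (T : Type) (P : set T) (Q : T -> nat -> Prop) :
  finite_set P -> (forall d m m', (m <= m')%N -> Q d m -> Q d m') ->
  (forall d, P d -> exists m, Q d m) -> exists m, forall d, P d -> Q d m.
Proof.
move=> finP Qmono PQ.
have [f fP] : {f : T -> nat & forall d, P d -> Q d (f d)}.
  apply: (@choice _ _ (fun d m => P d -> Q d m)) => d.
  by have [/PQ[m Qm]|nP] := pselect (P d); [exists m|exists 0%N].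
have [s es] := (finite_seqP _).1 (finite_image f finP).
exists (\max_(x <- s) x)%N => d Pd; apply: Qmono (fP _ Pd).
apply: leq_bigmax_seq => //.
by have : (f @` P) (f d) by [exists d]; rewrite es.
Qed.

Lemma floor_dist (R : realType) (x y : R) : 0 < y ->
  `|x - y * (Num.floor (x / y))%:~R| <= y.
Proof.
move=> y0; rewrite ger0_norm.
  by have := floorD1_gt (x / y); rewrite ltr_pdivrMr // intrD; lra.
by rewrite subr_ge0 mulrC -ler_pdivlMr // floor_le.
Qed.

(** The point [y * (2 * f + 1)] is the midpoint of the interval of length [2 * y] that contains [x].
    Odd multiples are what [colourD] requires. *)
Lemma floor_dist_odd (R : realType) (x y : R) : 0 < y ->
  `|x - y * (2 * (Num.floor (x / (2 * y)))%:~R + 1)| <= 2 * y.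
Proof.
move=> y0; have := floor_itv (x / (2 * y)).
rewrite ler_pdivlMr ?ltr_pdivrMr ?mulr_gt0 // intrD ler_norml => /andP[? ?].
by apply/andP; split; lra.
Qed.

Section Repetitive.
Context {R : realType} (a b : R) (n : nat).
Context (ha : 0 < a) (hb : 0 < b) (hn : (2 <= n)%N).
Context (hab : b / a = ln (n%:R : R) / ln (2 : R)).
Implicit Types (i j k : int) (p g h : Sol a b).

Local Notation N := (n%:R : R).
Local Notation vertex := (@vertex R a b n).
Local Notation tile i j k := (tile_map a b i j k @` hatP a b).

Let N0 : 0 < N. Proof. by rewrite ltr0n ltnW. Qed.
Let N_neq0 : N != 0. Proof. exact: lt0r_neq0. Qed.

Lemma tile_bounded i j k : exists m : nat, forall p, tile i j k p ->
  [/\ `|p.1.1| <= m%:R, `|p.1.2| <= m%:R & `|p.2| <= m%:R].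
Proof.
rewrite (tile_mapE ha hn hab).
pose v := vertex i j k.
have P2 : 0 < 2 ^ i :> R by rewrite exprz_gt0.
have PN : 0 < (N ^ i)^-1 by rewrite invr_gt0 exprz_gt0.
have L4 : 0 <= ln 4 / a by rewrite divr_ge0 ?ln_ge0 ?ler1n // ltW.
pose B := `|v.1.1| + `|v.1.2| + `|v.2| + 2 ^ i + (N ^ i)^-1 + ln 4 / a.
have B0 : 0 <= B by rewrite !addr_ge0 // ltW.
exists (Num.bound B) => _ [w /(hatP_box ha hn hab) [hx hy hz] <-].
have {}B0 := ltW (archi_boundP B0).
rewrite /ltrans /= (expR_level ha) (expR_levelN ha hn hab) -/v.
have nx := normr_ge0 v.1.1; have ny := normr_ge0 v.1.2; have nz := normr_ge0 v.2.
have ax : `|2 ^ i * w.1.1| <= 2 ^ i.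
  by rewrite normrM gtr0_norm // ger0_norm; [rewrite ler_piMr ?(ltW P2) //|]; lra.
have ay : `|(N ^ i)^-1 * w.1.2| <= (N ^ i)^-1.
  by rewrite normrM gtr0_norm // ger0_norm; [rewrite ler_piMr ?(ltW PN) //|]; lra.
have az : `|w.2| <= ln 4 / a by rewrite ger0_norm; lra.
by split; (apply: le_trans (ler_normD _ _) (le_trans _ B0); rewrite /B /v /=;
  move: nx ny nz; rewrite /v /= => *; lra).
Qed.

(** For [|i| <= M] the factors [2 ^ M / 2 ^ i] and [n ^ M * n ^ i] are integers, so the translation
    sends tiles of level [i] to tiles. *)
Lemma vertex_shift (M : nat) (I J K i j k : int) : (`|i| <= M)%N ->
  exists j' k',
    (vertex I (2 ^+ M * J) (n%:Z ^+ M * K) * vertex i j k)%g = vertex (I + i) j' k'.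
Proof.
move=> iM.
exists (j + 2 ^+ `|M%:Z - i| * J), (k + n%:Z ^+ `|M%:Z + i| * K).
apply: vertexM => //; rewrite !(intrD, intrM) !rmorphXn /=.
- rewrite !exprnP gez0_abs; last by lia.
  by rewrite expfzDr // -invr_expz; ring.
- rewrite !exprnP gez0_abs; last by lia.
  by rewrite -pmulrn expfzDr // ; ring.
Qed.

Lemma vertex_locK i j k p :
  (vertex i j k *
    ((locx i p - j%:~R, locy n i p - k%:~R, p.2 - level a i) : Sol a b))%g = p.
Proof.
rewrite [RHS]surjective_pairing [p.1]surjective_pairing.
congr (_, _, _) => /=.
- by rewrite (expR_level ha) /locx; field; rewrite expfz_neq0.
- by rewrite (expR_levelN ha hn hab) /locy; field; rewrite expfz_neq0.
- by rewrite addrC subrK.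
Qed.

Lemma decorated_repetitive :
  repetitive (dtile_act a b bool) fst (decorate (hatT a b) (@tile_colour R a b)).
Proof.
move=> P [finP PT].
(* A single number bounds both the level and the extent of a tile, and can be made uniform over the
   patch. *)
pose Q (d : set (Sol a b) * bool) (m : nat) := exists i j k,
  [/\ d = (tile i j k, colour i), (`|i| <= m)%N & forall p, tile i j k p ->
  [/\ `|p.1.1| <= m%:R, `|p.1.2| <= m%:R & `|p.2| <= m%:R]].
have [M PM] : exists M, forall d, P d -> Q d M.
  apply: finite_set_uniform => //.
    move=> d m m' mm' [i [j [k [-> im bm]]]]; exists i, j, k; split=> //.
      exact: leq_trans mm'.
    have {}mm' : m%:R <= m'%:R :> R by rewrite ler_nat.
    by move=> p /bm [? ? ?]; split; exact: le_trans mm'.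
  move=> d /PT [_ [i [j [k ->]]] <-].
  have [m bm] := tile_bounded i j k.
  exists (maxn m `|i|), i, j, k; split; rewrite ?leq_maxr //.
    by rewrite (tile_colourE ha hn hab).
  have {}mm' : m%:R <= (maxn m `|i|)%:R :> R by rewrite ler_nat leq_maxl.
  by move=> p /bm [? ? ?]; split; exact: le_trans mm'.
have l2 : 0 < ln (2 : R) / a by rewrite divr_gt0 // ln_gt0 // ltr1n.
pose A : R := 2 ^+ (2 * M).
have A0 : 0 < A by rewrite exprn_gt0.
have X0 : 0 < 2 ^+ M :> R by rewrite exprn_gt0.
have Y0 : 0 < N ^+ M by rewrite exprn_gt0.
(* The terms bound the differences of height, first and second coordinate after translation back by
   [g], with the metric weights at heights of absolute value at most [M]; the 1 makes the inequality
   strict. *)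
pose r := 1 + ((M%:R + 2 * A * (ln 2 / a)) +
  (expR (a * M%:R) * (M%:R + 2 ^+ M) + expR (b * M%:R) * (M%:R + N ^+ M))).
have r0 : 0 < r.
  have h1 : 0 < 2 * A * (ln 2 / a) by apply: mulr_gt0 => //; exact: mulr_gt0.
  have MX : 0 <= M%:R + 2 ^+ M :> R by rewrite addr_ge0 // ltW.
  have MY : 0 <= M%:R + N ^+ M by rewrite addr_ge0 // ltW.
  have h2 := mulr_ge0 (expR_ge0 (a * M%:R)) MX.
  have h3 := mulr_ge0 (expR_ge0 (b * M%:R)) MY.
  have M0 : 0 <= M%:R :> R := ler0n _ _.
  by rewrite /r; lra.
exists r => // q.
(* The centre [q] is rounded to an admissible translation: first the level [I], then the horizontal
   indices in the coordinates of that level. The remainder is [d], with [q = g * d]. *)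
pose Z := q.2 / (ln 2 / a).
pose t := Num.floor (Z / (2 * A)).
pose I : int := 2 ^+ (2 * M) * (2 * t + 1).
have IA : I%:~R = A * (2 * t%:~R + 1) :> R.
  by rewrite /I intrM intrD intrM rmorphXn.
pose J0 := Num.floor (locx I q / 2 ^+ M).
pose K0 := Num.floor (locy n I q / N ^+ M).
pose J : int := 2 ^+ M * J0; pose K : int := n%:Z ^+ M * K0.
pose g := vertex I J K.
pose d : Sol a b := (locx I q - J%:~R, locy n I q - K%:~R, q.2 - level a I).
have gd : (g * d)%g = q by exact: vertex_locK.
have dx : `|d.1.1| <= 2 ^+ M by rewrite /d /= /J intrM rmorphXn /= floor_dist.
have dy : `|d.1.2| <= N ^+ M by rewrite /d /= /K intrM rmorphXn /= floor_dist.
have dz : `|d.2| <= 2 * A * (ln 2 / a).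
  have -> : d.2 = (Z - I%:~R) * (ln 2 / a).
    by rewrite /d /= /level /Z mulrBl divfK // gt_eqF.
  rewrite normrM [`|ln 2 / a|]gtr0_norm // ler_pM2r //.
  by rewrite IA; exact: floor_dist_odd.
have act_tile i j k : (`|i| <= M)%N -> exists j' k',
    tile_act a b g (tile i j k) = tile (I + i) j' k'.
  move=> iM; have [j' [k' e]] := vertex_shift I J0 K0 j k iM.
  by exists j', k'; rewrite (tile_act_tile ha hn hab) e (tile_mapE ha hn hab).
exists g; split.
  split; first exact: finite_image.
  move=> _ [_ /PM [i [j [k [-> iM _]]]] <-].
  have [j' [k' e]] := act_tile i j k iM.
  exists (tile (I + i) j' k'); first by exists (I + i), j', k'.
  rewrite /dtile_act e (tile_colourE ha hn hab) colourD //.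
  apply: leq_ltn_trans iM _; apply: leq_trans (ltn_expl _ (ltnSn 1)) _.
  by rewrite leq_exp2l // leq_pmull.
move=> _ [_ [_ /PM [i [j [k [-> iM bM]]]] <-] [p /bM [px py pz] <-]].
rewrite /sol_ball /= -{1}gd; apply: le_lt_trans (sol_dist_mul_le _ _ _) _.
have cr (x y u v : R) : `|x| <= u -> `|y| <= v -> `|x - y| <= u + v.
  by move=> xu yv; apply: le_trans (ler_normB _ _) _; exact: lerD.
rewrite /r; apply: (@le_lt_trans _ _ (r - 1)); last by rewrite /r; lra.
rewrite /r [1 + _]addrC addrK; apply: lerD; first exact: cr.
move: pz; rewrite ler_norml => /andP[pz1 pz2].
apply: lerD; apply: ler_pM; rewrite ?expR_ge0 ?cr // ler_expR -?mulrN ler_pM2l //.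
by rewrite lerNl.
Qed.

(** A plain patch is labelled by [lab], moved as a decorated patch, and its labels are then
    forgotten. *)
Lemma undecorated_repetitive (C : Type) (lab : set (Sol a b) -> C)
    (T : set (set (Sol a b))) :
  repetitive (dtile_act a b C) fst (decorate T lab) -> repetitive (tile_act a b) id T.
Proof.
move=> rep P [finP PT].
have [] := rep [set (t, lab t) | t in P].
  by split; [exact: finite_image|move=> _ [t Pt <-]; exists t => //; exact: PT].
move=> r r0 H; exists r => // q; have [g [[_ gT] gq]] := H q; exists g; split.
  split; first exact: finite_image.
  move=> _ [t Pt <-]; have [|s Ts [<- _]] := gT (tile_act a b g t, lab t).
    by exists (t, lab t) => //; exists t.
  exact: Ts.
move=> p [_ [t Pt <-] tp]; apply: gq; exists (tile_act a b g t, lab t) => //.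
by exists (t, lab t) => //; exists t.
Qed.

End Repetitive.

Theorem proposition2 (R : realType) (a b : R) (n : nat) (ha : 0 < a) (hb : 0 < b)
    (hn : (2 <= n)%N) (hab : b / a = ln (n%:R : R) / ln (2 : R)) :
  [/\ is_tiling (hatT a b),
      face_to_face a b n,
      repetitive (tile_act a b) id (hatT a b)
    & exists (C : finType) (lab : set (Sol a b) -> C),
        repetitive (dtile_act a b C) fst (decorate (hatT a b) lab) /\
        aperiodic (dtile_act a b C) (decorate (hatT a b) lab)].
Proof.
have rep := decorated_repetitive ha hb hn hab.
split.
- exact: hatT_tiling ha hn hab.
- exact: hatT_face_to_face ha hn hab.
- exact: undecorated_repetitive rep.
- exists bool, (@tile_colour R a b); split=> //.
  exact: decorated_aperiodic ha hn hab.
Qed.
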